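(* Let $p$ be a prime, let $n,k,l$ be positive integers with $l\mid k$, and put $d=\gcd(n,k)$, $e=\gcd(n,l)$, $L=\operatorname{lcm}(d,l)$. Suppose that $\frac{k}{l}$ is even. 1. If $\frac{d}{e}$ is even, then $$\{x\in \mathbb{F}_{p^n}\mid S_l^k(x)=0\}=\begin{cases}\mathbb{F}_{p^d}, & \text{if } p\mid \frac{k}{L},\\ T_e^{2e}(\mathbb{F}_{p^d}), & \text{otherwise,}\end{cases}$$ and consequently $$\#\{x\in \mathbb{F}_{p^n}\mid S_l^k(x)=0\}=\begin{cases}p^{d}, & \text{if } p\mid \frac{k}{L},\\ p^{d-e}, & \text{otherwise.}\end{cases}$$ 2. If $\frac{d}{e}$ is odd, then $$\{x\in \mathbb{F}_{p^n}\mid S_l^k(x)=0\}=\mathbb{F}_{p^d},$$ and consequently $\#\{x\in \mathbb{F}_{p^n}\mid S_l^k(x)=0\}=p^d$.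
   Context: For positive integers $u\mid v$ and a prime $p$, define the linearized polynomials $T_u^v(X)=\sum_{i=0}^{v/u-1}X^{p^{ui}}$ and $S_u^v(X)=\sum_{i=0}^{v/u-1}(-1)^iX^{p^{ui}}$; in particular $T_u^{2u}(X)=X+X^{p^u}$. All finite fields $\mathbb{F}_{p^m}$ are regarded as subfields of a fixed algebraic closure $\overline{\mathbb{F}_p}$. For a polynomial $F$ and a set $A$, $F(A)=\{F(x)\mid x\in A\}$. Since $d\mid k$ and $l\mid k$, $L$ divides $k$, and $e\mid d$. *)

(* Defs.v *)
From HB Require Import structures.
From mathcomp Require Import all_boot all_order all_algebra all_field.
From mathcomp Require Import finmap.
From mathcomp Require Import mathcomp_extra boolp classical_sets functions.
From mathcomp Require Import cardinality.

Set Implicit Arguments.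
Unset Strict Implicit.
Unset Printing Implicit Defensive.
Import Order.TTheory GRing.Theory Num.Theory.
Local Open Scope classical_set_scope.
Local Open Scope card_scope.
Local Open Scope ring_scope.

(* Meaningful for positive u with u %| v, so that %/ is exact. *)
Definition linT (R : nzRingType) (p u v : nat) : {poly R} :=
  \sum_(i < (v %/ u)%N) 'X^(p ^ (u * i))%N.

Definition linS (R : nzRingType) (p u v : nat) : {poly R} :=
  \sum_(i < (v %/ u)%N) (-1) ^+ i *: 'X^(p ^ (u * i))%N.

Arguments linT : clear implicits.
Arguments linS : clear implicits.

Definition poly_image (R : nzRingType) (F : {poly R}) (A : set R) : set R :=
  [set F.[x] | x in A].

Definition zeros_in (R : nzRingType) (F : {poly R}) (A : set R) : set R :=
  [set x | A x /\ F.[x] = 0].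

(* The field of p ^ m elements inside an algebraically closed field K of
   characteristic p; GF_divring, card_GF and GF_unique show that it is a
   subfield of K with p ^ m elements, and the only one. *)
Definition GF (K : closedFieldType) (p m : nat) : set K :=
  [set x | x ^+ (p ^ m)%N = x].

Arguments GF : clear implicits.

Section GFTheory.
Variables (K : closedFieldType) (p : nat).
Hypothesis charKp : p \in [pchar K].

Let p_pr : prime p := pcharf_prime charKp.

Lemma GF_divring m :
  [/\ GF K p m 1, (forall x y, GF K p m x -> GF K p m y -> GF K p m (x - y)),
      (forall x y, GF K p m x -> GF K p m y -> GF K p m (x * y))
    & forall x, GF K p m x -> GF K p m x^-1].
Proof.
have Fr (x : K) : x ^+ (p ^ m)%N = iter m (pFrobenius_aut charKp) x.
  elim: m => [|n IH]; first by rewrite expn0 expr1.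
  by rewrite expnSr exprM IH /= pFrobenius_autE.
have FrB (x y : K) : (x - y) ^+ (p ^ m)%N = x ^+ (p ^ m)%N - y ^+ (p ^ m)%N.
  by rewrite !Fr; elim: m {Fr} => //= n ->; rewrite rmorphB.
split; rewrite /GF /=; first by rewrite expr1n.
- by move=> x y hx hy; rewrite FrB hx hy.
- by move=> x y hx hy; rewrite exprMn hx hy.
- by move=> x hx; rewrite exprVn hx.
Qed.

Lemma GF_seq m : (0 < m)%N ->
  exists2 s : seq K, uniq s /\ size s = (p ^ m)%N & GF K p m = [set` s].
Proof.
move=> m_gt0; set q := (p ^ m)%N.
have q_gt1 : (1 < q)%N by rewrite -(exp1n m) ltn_exp2r // prime_gt1.
pose f : {poly K} := 'X^q - 'X.
have szf : size f = q.+1.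
  by rewrite size_polyDl size_polyXn // size_polyN size_polyX ltnS.
have lcf : lead_coef f = 1.
  by rewrite lead_coefDl ?lead_coefXn // size_polyN size_polyX size_polyXn ltnS.
have [s fE] := closed_field_poly_normal f.
rewrite lcf scale1r in fE.
have sepf : separable_poly f.
  rewrite separable_poly.unlock derivB derivXn derivX.
  suff -> : 'X^(q.-1) *+ q = 0 :> {poly K}.
    by rewrite sub0r -scaleN1r coprimepZr ?coprimep1 // oppr_eq0 oner_eq0.
  rewrite -mulr_natr -polyC_natr /q natrX (pcharf0 charKp) expr0n.
  by rewrite eqn0Ngt m_gt0 /= polyC0 mulr0.
exists s.
  split; first by rewrite -separable_prod_XsubC -fE.
  by apply: succn_inj; rewrite -szf fE size_prod_XsubC.
apply/seteqP; split => x /=; rewrite -root_prod_XsubC -fE /root !hornerE.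
  by rewrite /GF /= => ->; rewrite subrr.
by rewrite subr_eq0 => /eqP.
Qed.

Lemma card_GF m : (0 < m)%N -> GF K p m #= `I_(p ^ m).
Proof.
move=> /GF_seq[s [us <-] ->].
have -> : [set` s] = [set` [fset x in s]%fset].
  by apply/seteqP; split => x /=; rewrite !inE.
by apply/card_eq_fsetP; rewrite card_fseq undup_id.
Qed.

Lemma GF_unique m (A : set K) : (0 < m)%N -> A #= `I_(p ^ m) ->
  A 1 -> (forall x y, A x -> A y -> A (x - y)) ->
  (forall x y, A x -> A y -> A (x * y)) -> A = GF K p m.
Proof.
move=> m_gt0 cA A1 AB AM.
have A0 : A 0 by rewrite -(subrr 1); apply: AB.
have [X AE] : exists X : {fset K}, A = [set` X].
  by apply/finite_fsetP; exists (p ^ m)%N.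
have cX : #|` X|%fset = (p ^ m)%N by apply/card_eq_fsetP; rewrite -AE.
have memX x : A x <-> x \in X by rewrite AE.
have [s [us sz] GE] := GF_seq m_gt0.
pose Y := (X `\ 0)%fset.
have cY : (#|` Y|%fset).+1 = (p ^ m)%N.
  by rewrite -cX (cardfsD1 0 X) (_ : 0 \in X) ?add1n //; apply/memX.
have sub x : x \in X -> x \in s.
  move=> xX; suff : GF K p m x by rewrite GE.
  rewrite /GF /=; have [->|x0] := eqVneq x 0.
    by rewrite expr0n eqn0Ngt expn_gt0 prime_gt0.
  have xY : perm_eq [seq x * y | y <- Y] Y.
    have uxY : uniq [seq x * y | y <- Y].
      by rewrite map_inj_uniq ?fset_uniq //; apply: mulfI.
    apply: uniq_perm => //; first exact: fset_uniq.
    have [|//] := uniq_min_size uxY (s2 := Y) _ (eq_leq (esym (size_map _ _))).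
    move=> _ /mapP[y yY ->]; move: yY; rewrite !inE => /andP[y0 yX].
    by rewrite mulf_neq0 //=; apply/memX/AM; apply/memX.
  have : \prod_(y <- [seq x * y | y <- Y]) y = \prod_(y <- Y) y by exact: perm_big.
  rewrite big_map big_split /= big_const_seq count_predT iter_mulr mulr1.
  have P0 : \prod_(i <- Y) i != 0 :> K.
    by rewrite prodf_seq_neq0; apply/allP => y; rewrite !inE => /andP[].
  by rewrite -{2}[\prod_(i <- Y) i]mul1r => /(mulIf P0) xq; rewrite -cY exprS xq mulr1.
have [|_ XsE] := uniq_min_size (fset_uniq X) sub; first by rewrite sz cX.
by rewrite GE AE; apply/seteqP; split=> x /=; rewrite XsE.
Qed.

End GFTheory.

(* Main.v *)
Require Import Defs.
From HB Require Import structures.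
From mathcomp Require Import all_boot all_order all_algebra all_field.
From mathcomp Require Import finmap.
From mathcomp Require Import mathcomp_extra boolp classical_sets functions.
From mathcomp Require Import cardinality.

(* Write s for the Frobenius map.  Since N := k / l is even,
   (1 + s^l) S_l^k = 1 - s^k, so the zeros of S_l^k lie in the field of p^k
   elements, hence in that of p^d elements when they lie in that of p^n.  On
   the latter field s^L = 1, so with D := d / e = L / l the sum S_l^k splits
   into k / L blocks of length D which agree up to the sign (-1)^D.  If D is odd
   they cancel in pairs.  If D is even they add up to k / L times
   the sum of the (- s^e)^(m i) for i < D, where m := l / e is odd and prime
   to D; as (- s^e)^D = 1, the factor m only permutes the terms, and the block
   is S_e^d.  Its kernel is the image of 1 + s^e: if S_e^d(x) = 0, solve
   y + s^e y = x in K; then y - s^d y = S_e^d(x) = 0.  Finally S_e^d is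
   separable of degree p^(d - e). *)

Set Implicit Arguments.
Unset Strict Implicit.
Unset Printing Implicit Defensive.
Import Order.TTheory GRing.Theory Num.Theory.
Local Open Scope classical_set_scope.
Local Open Scope card_scope.
Local Open Scope ring_scope.

(** Over [K] the polynomial splits into linear factors, and separability makes the list of roots
    duplicate-free. *)
Lemma card_roots_separable (K : closedFieldType) (f : {poly K}) :
  f != 0 -> separable_poly f -> [set x | root f x] #= `I_(size f).-1.
Proof.
move=> f0 sepf; have [s fE] := closed_field_poly_normal f.
have lf0 : lead_coef f != 0 by rewrite lead_coef_eq0.
have us : uniq s.
  rewrite -separable_prod_XsubC; move: sepf; rewrite separable_poly.unlock {1 2}fE.
  by rewrite derivZ coprimepZl // coprimepZr.
have szs : (size f).-1 = size s by rewrite fE size_scale // size_prod_XsubC.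
have -> : [set x | root f x] = [set` [fset x in s]%fset].
  by apply/seteqP; split => x /=; rewrite !inE fE rootZ // root_prod_XsubC.
by apply/card_eq_fsetP; rewrite card_fseq undup_id.
Qed.

Lemma GF_dvd (K : closedFieldType) (p a b : nat) (x : K) :
  (a %| b)%N -> GF K p a x -> GF K p b x.
Proof.
move=> /dvdnP[c ->] xa; rewrite /GF /=; elim: c => [|c IH].
  by rewrite mul0n expn0 expr1.
by rewrite mulSn expnD exprM xa.
Qed.

(** By Bezout [u * a = v * b + gcdn a b]; the first two of these Frobenius powers fix [x], hence so
    does the third. *)
Lemma GF_gcdn (K : closedFieldType) (p a b : nat) (x : K) : (0 < a)%N ->
  GF K p a x -> GF K p b x -> GF K p (gcdn a b) x.
Proof.
move=> a_gt0 xa xb; case: (egcdnP b a_gt0) => u v uv _.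
have := GF_dvd (dvdn_mull u (dvdnn a)) xa.
by rewrite /GF /= uv expnD exprM (GF_dvd (dvdn_mull v (dvdnn b)) xb).
Qed.

Lemma horner_linS (R : comNzRingType) (p u v : nat) (x : R) :
  (linS R p u v).[x] = \sum_(i < v %/ u) (-1) ^+ i * x ^+ (p ^ (u * i)).
Proof.
by rewrite horner_sum; apply: eq_bigr => i _; rewrite hornerZ hornerXn.
Qed.

Lemma horner_linT2 (R : comNzRingType) (p u : nat) (x : R) : (0 < u)%N ->
  (linT R p u (2 * u)).[x] = x + x ^+ (p ^ u).
Proof.
move=> u_gt0; rewrite /linT mulnK // !big_ord_recl big_ord0 addr0 muln0 muln1.
by rewrite expn0 !hornerE.
Qed.

Section Frobenius.
Variables (K : closedFieldType) (p : nat).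
Hypothesis charKp : p \in [pchar K].

Let p_pr : prime p := pcharf_prime charKp.

Lemma frobD m (x y : K) :
  (x + y) ^+ (p ^ m) = x ^+ (p ^ m) + y ^+ (p ^ m).
Proof. by rewrite exprDn_pchar // pnatX pnatE ?charKp. Qed.

Lemma frob_sign m i : ((-1) ^+ i) ^+ (p ^ m) = (-1) ^+ i :> K.
Proof.
(* Additivity of Frobenius at [1 + (-1) = 0] treats [p = 2] and odd [p] alike. *)
rewrite exprAC; congr (_ ^+ _); apply/eqP; rewrite -subr_eq0 opprK addrC.
rewrite -{1}(expr1n K (p ^ m)) -frobD subrr expr0n.
by rewrite eqn0Ngt expn_gt0 prime_gt0.
Qed.

Lemma horner_linS_frob u v m (x : K) :
  (linS K p u v).[x ^+ (p ^ m)] = (linS K p u v).[x] ^+ (p ^ m).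
Proof.
rewrite !horner_linS (big_morph _ (frobD m) (_ : 0 ^+ (p ^ m) = 0)).
  by apply: eq_bigr => i _; rewrite exprMn frob_sign exprAC.
by rewrite expr0n eqn0Ngt expn_gt0 prime_gt0.
Qed.

Lemma horner_linSD u v (x y : K) :
  (linS K p u v).[x + y] = (linS K p u v).[x] + (linS K p u v).[y].
Proof.
rewrite !horner_linS -big_split; apply: eq_bigr => i _.
by rewrite frobD mulrDr.
Qed.

Lemma linS_telescope u v (x : K) : (u %| v)%N -> ~~ odd (v %/ u) ->
  (linS K p u v).[x + x ^+ (p ^ u)] = x - x ^+ (p ^ v).
Proof.
move=> /divnK uv Nev; rewrite horner_linS.
(* With this sign put back, the identity holds for every number of terms, so induction applies. *)
have -> : x ^+ (p ^ v) = (-1) ^+ (v %/ u) * x ^+ (p ^ (u * (v %/ u))).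
  by rewrite -signr_odd (negPf Nev) mul1r mulnC uv.
elim: (v %/ u)%N => [|N IH]; first by rewrite big_ord0 muln0 mul1r subrr.
rewrite big_ord_recr IH /= frobD -exprM -expnD -mulnS exprS mulN1r.
by rewrite mulNr opprK mulrDr addrA subrK.
Qed.

(** The alternating sum is additive and commutes with Frobenius, so it kills [x + x ^+ (p ^ u)]
    along with [x]; telescoping concludes. *)
Lemma GF_linS_root u v (x : K) : (u %| v)%N -> ~~ odd (v %/ u) ->
  (linS K p u v).[x] = 0 -> GF K p v x.
Proof.
move=> uv Nev Sx; apply/esym/eqP; rewrite -subr_eq0 -(linS_telescope x uv Nev).
rewrite horner_linSD horner_linS_frob Sx add0r expr0n.
by rewrite eqn0Ngt expn_gt0 prime_gt0.
Qed.

Lemma linS_root_image u v (x : K) : (0 < u)%N -> (u %| v)%N ->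
  ~~ odd (v %/ u) ->
  (linS K p u v).[x] = 0 <-> exists2 y, GF K p v y & y + y ^+ (p ^ u) = x.
Proof.
move=> u_gt0 uv Nev; split=> [Sx|[y yv <-]]; last first.
  by rewrite linS_telescope // yv subrr.
have q_gt1 : (1 < p ^ u)%N by rewrite -(exp1n u) ltn_exp2r // prime_gt1.
(* A root of this polynomial is a preimage of [x] under [1 + s^u]; it is nonconstant because
   [p ^ u > 1] keeps the leading term. *)
have [|y] := closed_rootP ('X^(p ^ u) + ('X - x%:P)) _.
  by rewrite size_polyDl size_polyXn ?size_XsubC // eqSS -lt0n ltnW.
rewrite /root !hornerE subr_eq0 => /eqP /(etrans (addrC _ _)) yE.
exists y => //; apply/esym/eqP.
by rewrite -subr_eq0 -(linS_telescope y uv Nev) yE Sx.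
Qed.

(** Every exponent but the first is divisible by [p]. A constant derivative yields separability. *)
Lemma deriv_linS u v : (0 < u)%N -> (0 < v %/ u)%N -> (linS K p u v)^`() = 1.
Proof.
rewrite /linS; case: (v %/ u)%N => // N u_gt0 _.
rewrite big_ord_recl muln0 expn0 expr0 scale1r derivD derivX raddf_sum.
rewrite big1 ?addr0 // => i _; rewrite /= derivZ derivXn -mulr_natr -polyC_natr.
by rewrite natrX (pcharf0 charKp) expr0n muln_eq0 eqn0Ngt u_gt0 mulr0 scaler0.
Qed.

Lemma size_linS u v : (0 < u)%N -> (u %| v)%N -> (0 < v %/ u)%N ->
  size (linS K p u v) = (p ^ (v - u)).+1.
Proof.
move=> u_gt0 /divnK uv; rewrite -[in RHS]uv /linS.
case: (v %/ u)%N => // N _; rewrite mulSn addKn mulnC big_ord_recr /= addrC.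
have szN : size ((-1) ^+ N *: 'X^(p ^ (u * N)) : {poly K}) = (p ^ (u * N)).+1.
  by rewrite size_scale ?signr_eq0 // size_polyXn.
rewrite size_polyDl szN // ltnS; apply: (leq_trans (size_sum _ _ _)).
apply/bigmax_leqP => i _; rewrite size_scale ?signr_eq0 // size_polyXn.
by rewrite ltn_exp2l ?prime_gt1 // ltn_pmul2l.
Qed.

Lemma card_linS_root u v : (0 < u)%N -> (u %| v)%N -> (0 < v %/ u)%N ->
  [set x | (linS K p u v).[x] = 0] #= `I_(p ^ (v - u)).
Proof.
move=> u_gt0 uv N_gt0; have sz := size_linS u_gt0 uv N_gt0.
have -> : [set x | (linS K p u v).[x] = 0] = [set x | root (linS K p u v) x].
  by apply/seteqP; split=> x /= /rootP.
rewrite -[(p ^ _)%N]/((p ^ (v - u)).+1.-1) -sz; apply: card_roots_separable.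
  by rewrite -size_poly_eq0 sz.
by rewrite separable_poly.unlock deriv_linS // coprimep1.
Qed.

(** Shifting the index by [D] multiplies each term by [(-1) ^+ D] only, since [s^(l * D)] fixes
    [x]. *)
Lemma linS_blocks l d D M (x : K) : (d %| l * D)%N -> GF K p d x ->
  \sum_(i < M * D) (-1) ^+ i * x ^+ (p ^ (l * i)) =
  (\sum_(j < M) (-1) ^+ (D * j)) *
    \sum_(i < D) (-1) ^+ i * x ^+ (p ^ (l * i)).
Proof.
move=> dlD xd; elim: M => [|M IH]; first by rewrite !big_ord0 mul0r.
rewrite mulSnr big_split_ord /= IH big_ord_recr /= mulrDl; congr (_ + _).
rewrite mulr_sumr; apply: eq_bigr => i _; rewrite exprD mulnDr expnD (exprM x).
rewrite [(M * D)%N]mulnC (_ : x ^+ (p ^ (l * (D * M))) = x) ?mulrA //.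
by apply: GF_dvd xd; rewrite mulnA dvdn_mulr.
Qed.

(* Both sides are the sum of (- s^e)^j x over the residues j modulo D, where s
   is the Frobenius map; oddness of m makes the signs match. *)
Lemma linS_block_coprime e m D (x : K) : ~~ odd D -> coprime m D ->
  GF K p (e * D) x ->
  \sum_(i < D) (-1) ^+ i * x ^+ (p ^ (e * m * i)) =
  \sum_(i < D) (-1) ^+ i * x ^+ (p ^ (e * i)).
Proof.
case: D => [|D] Dev mD xD; first by rewrite !big_ord0.
(* The term depends only on the residue of [j]: the even modulus preserves the sign, and
   [s^(e * D.+1)] fixes [x]. *)
have modE j : (-1) ^+ (j %% D.+1) * x ^+ (p ^ (e * (j %% D.+1))) =
    (-1) ^+ j * x ^+ (p ^ (e * j)) :> K.
  rewrite [in RHS](divn_eq j D.+1) exprD mulnDr expnD (exprM x).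
  rewrite -[(-1) ^+ (_ * _)]signr_odd oddM (negPf Dev) andbF mul1r.
  rewrite (_ : x ^+ (p ^ (e * (j %/ D.+1 * D.+1))) = x) //.
  by apply: GF_dvd xD; rewrite mulnCA dvdn_mull.
have modlt j : (j %% D.+1 < D.+1)%N by rewrite ltn_mod.
have m_odd : odd m.
  apply: contraT => mev; move: mD; rewrite /coprime => /eqP g1.
  have : (2 %| gcdn m D.+1)%N by rewrite dvdn_gcd !dvdn2 mev Dev.
  by rewrite g1.
rewrite [RHS](reindex_inj (h := fun i : 'I_D.+1 => Ordinal (modlt (m * i)%N))) /=.
  apply: eq_bigr => i _; rewrite modE mulnA.
  by rewrite -[(-1) ^+ (m * i)]signr_odd oddM m_odd signr_odd.
(* Injectivity of multiplication by [m] on residues: the modulus divides [m * (j - i)], and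
   coprimality cancels [m]. *)
move=> i j [/eqP]; wlog ij : i j / (i <= j)%N => [hw ijm|].
  by have [/hw->//|/ltnW/hw-> //] := leqP i j; rewrite eq_sym.
rewrite eq_sym eqn_mod_dvd ?leq_mul // -mulnBr Gauss_dvdr 1?coprime_sym //.
rewrite -eqn_mod_dvd // !modn_small // => /eqP ji.
by apply: val_inj.
Qed.

End Frobenius.

Theorem theorem2 (p : nat) (p_prime : prime p)
    (* K is an algebraic closure of the prime field *)
    (K : closedFieldType) (iota : {rmorphism 'F_p -> K})
    (K_alg : integralRange iota)
    (n k l : nat) (n_gt0 : (0 < n)%N) (k_gt0 : (0 < k)%N) (l_gt0 : (0 < l)%N)
    (l_dvd_k : (l %| k)%N) (kl_even : ~~ odd (k %/ l)) :
  let d := gcdn n k in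
  let e := gcdn n l in
  let L := lcmn d l in
  let Z := zeros_in (linS K p l k) (GF K p n) in
  (~~ odd (d %/ e) ->
     Z = (if (p %| k %/ L)%N then GF K p d
          else poly_image (linT K p e (2 * e)%N) (GF K p d))
     /\ Z #= `I_(if (p %| k %/ L)%N then p ^ d else p ^ (d - e))%N) /\
  (odd (d %/ e) -> Z = GF K p d /\ Z #= `I_(p ^ d)%N).
Proof.
move=> d e L Z.
have charKp : p \in [pchar K] by apply: (rmorph_pchar iota); rewrite pchar_Fp.
have d_gt0 : (0 < d)%N by rewrite gcdn_gt0 n_gt0.
have e_gt0 : (0 < e)%N by rewrite gcdn_gt0 n_gt0.
have eE : e = gcdn d l by rewrite /d -gcdnA (gcdn_idPr l_dvd_k).
have e_d : (e %| d)%N by rewrite eE dvdn_gcdl.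
have e_l : (e %| l)%N by rewrite eE dvdn_gcdr.
have LE : (L = l * (d %/ e))%N.
  by rewrite /L /lcmn -eE mulnC muln_divA.
have L_k : (L %| k)%N by rewrite dvdn_lcm dvdn_gcdr.
have D_gt0 : (0 < d %/ e)%N by rewrite divn_gt0 // dvdn_leq.
have klE : (k %/ l = k %/ L * (d %/ e))%N.
  by rewrite -{1}(divnK L_k) LE mulnCA mulKn.
have ZE : Z = [set x | GF K p d x /\ (linS K p l k).[x] = 0].
  apply/seteqP; split=> x /= [xn Sx]; split=> //.
    exact: GF_gcdn n_gt0 xn (GF_linS_root charKp l_dvd_k kl_even Sx).
  by apply: GF_dvd xn; rewrite dvdn_gcdl.
have SE x : GF K p d x -> (linS K p l k).[x] =
    (\sum_(j < k %/ L) (-1) ^+ (d %/ e * j)) *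
    \sum_(i < d %/ e) (-1) ^+ i * x ^+ (p ^ (l * i)).
  by move=> xd; rewrite horner_linS klE (linS_blocks _ _ xd) // -LE dvdn_lcml.
have ZfullE : (forall x, GF K p d x -> (linS K p l k).[x] = 0) -> Z = GF K p d.
  by rewrite ZE => S0; apply/seteqP; split=> x; [case | split; auto].
have cardZ : Z = GF K p d -> Z #= `I_(p ^ d)%N by move=> ->; apply: card_GF.
split=> [Dev|Dodd]; last first.
  suff ZGF : Z = GF K p d by split; last exact: cardZ.
  apply: ZfullE => x /SE ->.
  (* With [d %/ e] odd, the evenness of [k %/ l] passes to the number of blocks, so the alternating
     block signs sum to zero. *)
  have Mev : ~~ odd (k %/ L) by move: kl_even; rewrite klE oddM Dodd andbT.
  rewrite (eq_bigr (fun j : 'I__ => (-1) ^+ j)); last first.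
    by move=> j _; rewrite -signr_odd oddM Dodd signr_odd.
  rewrite -(odd_double_half (k %/ L)) (negPf Mev) add0n.
  elim: (k %/ L)./2 => [|h IH]; first by rewrite big_ord0 mul0r.
  by rewrite doubleS !big_ord_recr /= exprS mulN1r addrK.
have SE2 x : GF K p d x ->
    (linS K p l k).[x] = (k %/ L)%:R * (linS K p e d).[x].
  move=> xd; rewrite SE // horner_linS; congr (_ * _).
    rewrite (eq_bigr (fun=> 1)) ?sumr_const ?card_ord // => j _.
    by rewrite -signr_odd oddM (negPf Dev).
  have -> : l = (e * (l %/ e))%N by rewrite mulnC divnK.
  rewrite linS_block_coprime //.
    (* Coprimality of [l %/ e] and [d %/ e], checked after multiplying by [e], which is
       [gcdn d l]. *)
    rewrite /coprime -(eqn_pmul2r e_gt0) muln_gcdl !divnK // mul1n.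
    by rewrite gcdnC -eE.
  by rewrite mulnC divnK.
have pME : ((k %/ L)%:R == 0 :> K) = (p %| k %/ L)%N.
  by rewrite -(dvdn_pcharf charKp).
case: ifPn => pM.
  suff ZGF : Z = GF K p d by split; last exact: cardZ.
  by apply: ZfullE => x /SE2 ->; move: pM; rewrite -pME => /eqP ->; rewrite mul0r.
(* The factor [k %/ L] is now nonzero in [K], and all zeros of [linS K p e d] already lie in
   [GF K p d]. *)
have ZS : Z = [set x | (linS K p e d).[x] = 0].
  rewrite ZE; apply/seteqP; split=> x /= [].
    by move=> xd; rewrite SE2 // => /eqP; rewrite mulf_eq0 pME (negPf pM) => /eqP.
  move=> Sx; have xd := GF_linS_root charKp e_d Dev Sx.
  by rewrite SE2 // Sx mulr0.
split; last by rewrite ZS; apply: card_linS_root.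
rewrite ZS; apply/seteqP; split=> x /=.
  move=> /(linS_root_image charKp _ e_gt0 e_d Dev)[y yd <-].
  by exists y; rewrite ?horner_linT2.
move=> [y yd <-]; apply/(linS_root_image charKp _ e_gt0 e_d Dev).
by exists y; rewrite ?horner_linT2.
Qed.
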